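(* Let $\lambda>0$ and consider $(\mathfrak g_4,S_1^\lambda,J)$. For a real number $c$, the identity $\widetilde{\operatorname{Ric}}^0=c\operatorname{Id}+D$ holds for some derivation $D$ of $\mathfrak g_4$ (that is, $(\mathfrak g_4,S_1^\lambda,J)$ is a second kind algebraic Ricci soliton associated to $\nabla^0$ with constant $c$) if and only if $c=-\frac13$ and $\lambda=\frac13$. In that case, in the basis $\{v_1,v_2,v_3,v_4\}$, $$\widetilde{\operatorname{Ric}}^0=\begin{bmatrix}-\frac13&0&0&0\\0&\frac13&0&0\\0&0&\frac23&\frac13\\0&0&-\frac13&0\end{bmatrix},\qquad D=\begin{bmatrix}0&0&0&0\\0&\frac23&0&0\\0&0&1&\frac13\\0&0&-\frac13&\frac13\end{bmatrix}.$$
   Context: $\mathfrak g_4$ is the real Lie algebra with basis $e_1,e_2,e_3,e_4$ and non-zero brackets (up to skew-symmetry) $[e_1,e_2]=e_3$, $[e_1,e_3]=e_4$. For $\lambda>0$, $S_1^\lambda$ is the Lorentzian inner product $\langle\cdot,\cdot\rangle$ on $\mathfrak g_4$ whose matrix in $(e_1,e_2,e_3,e_4)$ is $\begin{bmatrix}1&0&0&0\\0&0&0&1\\0&0&\lambda&0\\0&1&0&0\end{bmatrix}$. Fix the basis $v_1=e_1$, $v_2=\frac1{\sqrt\lambda}e_3$, $v_3=\frac1{\sqrt2}(e_2+e_4)$, $v_4=\frac1{\sqrt2}(e_2-e_4)$, which is orthonormal: $\langle v_i,v_j\rangle=0$ for $i\ne j$, $\langle v_i,v_i\rangle=1$ for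 $i=1,2,3$, $\langle v_4,v_4\rangle=-1$. The product structure $J$ is the linear map with $Jv_i=v_i$ for $i=1,2,3$ and $Jv_4=-v_4$. Write $\mathfrak g$ for the Lie algebra. The Levi-Civita connection is the bilinear map $\nabla:\mathfrak g\times\mathfrak g\to\mathfrak g$ with $2\langle\nabla_uv,w\rangle=\langle[u,v],w\rangle+\langle[w,u],v\rangle+\langle[w,v],u\rangle$ for all $u,v,w$. Put $(\nabla_uJ)v=\nabla_u(Jv)-J(\nabla_uv)$. The canonical connection is $\nabla^0_uv=\nabla_uv-\frac12(\nabla_uJ)Jv$. Its curvature is $R^0_{uv}w=\nabla^0_{[u,v]}w-\nabla^0_u\nabla^0_vw+\nabla^0_v\nabla^0_uw$, its Ricci operator is $\operatorname{Ric}^0(u)=\sum_{k=1}^4\langle v_k,v_k\rangle R^0_{v_ku}v_k$, and $\rho^0(u,v)=\langle\operatorname{Ric}^0(u),v\rangle$. Put $\widetilde\rho^0(u,v)=\frac12(\rho^0(u,v)+\rho^0(v,u))$ and define the operator $\widetilde{\operatorname{Ric}}^0$ by $\langle\widetilde{\operatorname{Ric}}^0(u),v\rangle=\widetilde\rho^0(u,v)$. A derivation of $\mathfrak g$ is a linear map $D:\mathfrak g\to\mathfrak g$ with $[D(u),v]+[u,D(v)]=D[u,v]$ for all $u,v\in\mathfrak g$. In matrices, the $j$-th column contains the coordinates of the image of $v_j$ in the basis $(v_1,v_2,v_3,v_4)$. *)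

(* Defs.v *)
From HB Require Import structures.
From mathcomp Require Import all_boot all_order all_algebra.
From mathcomp Require Import reals.
From mathcomp Require Import ring lra.
Set Implicit Arguments.
Unset Strict Implicit.
Unset Printing Implicit Defensive.
Import Order.TTheory GRing.Theory Num.Theory.
Local Open Scope ring_scope.

(* Vectors of g_4 are the columns of their coordinates in (e_1, ..., e_4).
   Indices live in 'I_4, so e_1, ..., e_4 are [e 0], ..., [e 3], and the same
   shift applies to the entries of [frame]. *)
Notation g4 R := 'cV[R]_4.

Definition mx4 (R : realType) (rows : seq (seq R)) : 'M[R]_4 :=
  \matrix_(i, j) nth 0 (nth [::] rows i) j.

Definition e (R : realType) (k : 'I_4) : g4 R := delta_mx k 0.

(* Bilinear alternating extension of [e_1, e_2] = e_3, [e_1, e_3] = e_4. *)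
Definition bracket (R : realType) (x y : g4 R) : g4 R :=
  (x 0 0 * y 1 0 - x 1 0 * y 0 0) *: e R 2
  + (x 0 0 * y 2 0 - x 2 0 * y 0 0) *: e R 3.

Definition is_derivation (R : realType) (D : g4 R -> g4 R) : Prop :=
  forall u v, bracket (D u) v + bracket u (D v) = D (bracket u v).

Definition gram (R : realType) (lam : R) : 'M[R]_4 :=
  mx4 [:: [:: 1; 0; 0; 0];
          [:: 0; 0; 0; 1];
          [:: 0; 0; lam; 0];
          [:: 0; 1; 0; 0]].

Definition ip (R : realType) (lam : R) (u v : g4 R) : R :=
  (u^T *m gram lam *m v) 0 0.

Definition frame (R : realType) (lam : R) : 4.-tuple (g4 R) :=
  [tuple e R 0;
         (Num.sqrt lam)^-1 *: e R 2;
         (Num.sqrt 2)^-1 *: (e R 1 + e R 3);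
         (Num.sqrt 2)^-1 *: (e R 1 - e R 3)].

(* Column j holds the coordinates of f v_j in the frame; this is the
   transpose of the convention of [mxof]. *)
Definition frame_mx (R : realType) (lam : R) (f : g4 R -> g4 R) : 'M[R]_4 :=
  \matrix_(i, j) coord (frame lam) i (f (frame lam)`_j).

Definition J (R : realType) (lam : R) (u : g4 R) : g4 R :=
  \sum_(i < 4) ((if i == 3 then -1 else 1) * coord (frame lam) i u)
    *: (frame lam)`_i.

(* The vector representing a linear form f through the metric:
   see [ip_sharp] and [sharp_unique]. *)
Definition sharp (R : realType) (lam : R) (f : g4 R -> R) : g4 R :=
  invmx (gram lam) *m \col_k f (e R k).

(* The Levi-Civita connection, from its Koszul formula. *)
Definition nabla (R : realType) (lam : R) (u v : g4 R) : g4 R :=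
  sharp lam (fun w => 2^-1 * (ip lam (bracket u v) w
                              + ip lam (bracket w u) v
                              + ip lam (bracket w v) u)).

Definition nablaJ (R : realType) (lam : R) (u v : g4 R) : g4 R :=
  nabla lam u (J lam v) - J lam (nabla lam u v).

Definition nabla0 (R : realType) (lam : R) (u v : g4 R) : g4 R :=
  nabla lam u v - 2^-1 *: nablaJ lam u (J lam v).

Definition R0 (R : realType) (lam : R) (u v w : g4 R) : g4 R :=
  nabla0 lam (bracket u v) w
  - nabla0 lam u (nabla0 lam v w)
  + nabla0 lam v (nabla0 lam u w).

Definition Ric0 (R : realType) (lam : R) (u : g4 R) : g4 R :=
  \sum_(k < 4) ip lam (frame lam)`_k (frame lam)`_k
    *: R0 lam (frame lam)`_k u (frame lam)`_k.

Definition rho0 (R : realType) (lam : R) (u v : g4 R) : R :=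
  ip lam (Ric0 lam u) v.

Definition sym_rho0 (R : realType) (lam : R) (u v : g4 R) : R :=
  2^-1 * (rho0 lam u v + rho0 lam v u).

Definition sym_Ric0 (R : realType) (lam : R) (u : g4 R) : g4 R :=
  sharp lam (sym_rho0 lam u).

Definition soliton_eq (R : realType) (lam c : R) (D : g4 R -> g4 R) : Prop :=
  forall u, sym_Ric0 lam u = c *: u + D u.

Definition second_kind_soliton (R : realType) (lam c : R) : Prop :=
  exists D : {linear g4 R -> g4 R}, is_derivation D /\ soliton_eq lam c D.

Lemma ord4E (P : 'I_4 -> Prop) : P 0 -> P 1 -> P 2 -> P 3 -> forall i, P i.
Proof.
move=> P0 P1 P2 P3; case=> [[|[|[|[|//]]]] h].
- by have -> : Ordinal h = 0 by apply: val_inj.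
- by have -> : Ordinal h = 1 by apply: val_inj.
- by have -> : Ordinal h = 2 by apply: val_inj.
- by have -> : Ordinal h = 3 by apply: val_inj.
Qed.

Lemma sum4E (V : zmodType) (F : 'I_4 -> V) :
  \sum_(i < 4) F i = F 0 + F 1 + F 2 + F 3.
Proof.
rewrite !big_ord_recr big_ord0 /= GRing.add0r.
by congr (F _ + F _ + F _ + F _); apply: val_inj.
Qed.

Lemma eqV4 (R : realType) (u v : g4 R) :
  u 0 0 = v 0 0 -> u 1 0 = v 1 0 -> u 2 0 = v 2 0 -> u 3 0 = v 3 0 -> u = v.
Proof.
move=> h0 h1 h2 h3; apply/matrixP => i j; rewrite (ord1 j).
by move: i; apply: ord4E.
Qed.

Lemma bracketC (R : realType) (x y : g4 R) : bracket x y = - bracket y x.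
Proof. by apply: eqV4; rewrite !mxE /=; ring. Qed.

Lemma bracketPl (R : realType) (a : R) (x y z : g4 R) :
  bracket (a *: x + y) z = a *: bracket x z + bracket y z.
Proof. by apply: eqV4; rewrite !mxE /=; ring. Qed.

Lemma bracketPr (R : realType) (a : R) (x y z : g4 R) :
  bracket z (a *: x + y) = a *: bracket z x + bracket z y.
Proof. by apply: eqV4; rewrite !mxE /=; ring. Qed.

Lemma bracket_jacobi (R : realType) (x y z : g4 R) :
  bracket x (bracket y z) + bracket y (bracket z x)
  + bracket z (bracket x y) = 0.
Proof. by apply: eqV4; rewrite !mxE /=; ring. Qed.

Lemma bracket_e01 (R : realType) : bracket (e R 0) (e R 1) = e R 2.
Proof. by apply: eqV4; rewrite !mxE /=; ring. Qed.

Lemma bracket_e02 (R : realType) : bracket (e R 0) (e R 2) = e R 3.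
Proof. by apply: eqV4; rewrite !mxE /=; ring. Qed.

Lemma bracket_e0 (R : realType) :
  [/\ bracket (e R 0) (e R 3) = 0, bracket (e R 1) (e R 2) = 0,
      bracket (e R 1) (e R 3) = 0 & bracket (e R 2) (e R 3) = 0].
Proof. by split; apply: eqV4; rewrite !mxE /=; ring. Qed.

Lemma ipE (R : realType) (lam : R) (u v : g4 R) :
  ip lam u v = u 0 0 * v 0 0 + u 1 0 * v 3 0 + lam * u 2 0 * v 2 0
               + u 3 0 * v 1 0.
Proof. by rewrite /ip mxE sum4E !mxE !sum4E !mxE /=; ring. Qed.

Lemma gram_unit (R : realType) (lam : R) : 0 < lam -> gram lam \in unitmx.
Proof.
move=> lam0; have lam_neq0 : lam != 0 by rewrite gt_eqF.
pose H := mx4 [:: [:: 1; 0; 0; 0]; [:: 0; 0; 0; 1];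
                  [:: 0; 0; lam^-1; 0]; [:: 0; 1; 0; 0]].
suff /mulmx1_unit[] : gram lam *m H = 1%:M by [].
apply/matrixP => i j; rewrite mxE sum4E !mxE.
by move: i j; apply: ord4E; apply: ord4E => /=; field.
Qed.

Lemma gram_sym (R : realType) (lam : R) : (gram lam)^T = gram lam.
Proof. by apply/matrixP; apply: ord4E; apply: ord4E; rewrite !mxE. Qed.

Lemma ipC (R : realType) (lam : R) (u v : g4 R) : ip lam u v = ip lam v u.
Proof. by rewrite !ipE; ring. Qed.

Lemma ipPl (R : realType) (lam a : R) (u v w : g4 R) :
  ip lam (a *: u + v) w = a * ip lam u w + ip lam v w.
Proof. by rewrite !ipE !mxE; ring. Qed.

Lemma ipPr (R : realType) (lam a : R) (u v w : g4 R) :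
  ip lam w (a *: u + v) = a * ip lam w u + ip lam w v.
Proof. by rewrite !ipE !mxE; ring. Qed.

Lemma ip_nondeg (R : realType) (lam : R) (u u' : g4 R) : 0 < lam ->
  (forall v, ip lam u v = ip lam u' v) -> u = u'.
Proof.
move=> lam0 h; apply: trmx_inj.
rewrite -[LHS](mulmxK (gram_unit lam0)) -[RHS](mulmxK (gram_unit lam0)).
congr (_ *m _); apply/matrixP => i j; rewrite (ord1 i).
by have := h (e R j); rewrite /ip /e -colE -colE !mxE.
Qed.

Lemma vecE (R : realType) (v : g4 R) : v = \sum_(k < 4) v k 0 *: e R k.
Proof. by apply: eqV4; rewrite sum4E !mxE /=; ring. Qed.

Lemma ip_sharp (R : realType) (lam : R) (f : g4 R -> R) : 0 < lam ->
  (forall a x y, f (a *: x + y) = a * f x + f y) ->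
  forall v, ip lam (sharp lam f) v = f v.
Proof.
move=> lam0 flin v.
have f0 : f 0 = 0 by have := flin (-1) 0 0; rewrite scaler0 addr0; lra.
have fv : f v = \sum_(k < 4) v k 0 * f (e R k).
  rewrite {1}[v]vecE !sum4E -!addrA !flin.
  by rewrite -[_ *: e R 3]addr0 flin f0; ring.
rewrite /ip /sharp trmx_mul trmx_inv gram_sym mulmxKV ?gram_unit //.
by rewrite mxE fv; apply: eq_bigr => k _; rewrite !mxE mulrC.
Qed.

Lemma sharp_unique (R : realType) (lam : R) (f : g4 R -> R) (u : g4 R) :
  0 < lam -> (forall a x y, f (a *: x + y) = a * f x + f y) ->
  (forall v, ip lam u v = f v) -> u = sharp lam f.
Proof.
by move=> lam0 flin h; apply: (ip_nondeg lam0) => v; rewrite h ip_sharp.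
Qed.

Lemma koszul (R : realType) (lam : R) (u v w : g4 R) : 0 < lam ->
  2 * ip lam (nabla lam u v) w =
  ip lam (bracket u v) w + ip lam (bracket w u) v + ip lam (bracket w v) u.
Proof.
move=> lam0; rewrite ip_sharp // => [|a x y]; first by field.
by rewrite !(bracketPl, ipPl, ipPr); ring.
Qed.

Lemma nablaPl (R : realType) (lam a : R) (x y v : g4 R) : 0 < lam ->
  nabla lam (a *: x + y) v = a *: nabla lam x v + nabla lam y v.
Proof.
move=> lam0; apply: (ip_nondeg lam0) => w; apply: (@mulfI _ 2); first by lra.
have := koszul (a *: x + y) v w lam0.
have := koszul x v w lam0; have := koszul y v w lam0.
generalize (nabla lam (a *: x + y) v) (nabla lam x v) (nabla lam y v).
move=> N X Y hY hX ->; rewrite ipPl mulrDr mulrCA hX hY.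
by rewrite !(bracketPl, bracketPr, ipPl, ipPr); ring.
Qed.

Lemma nablaPr (R : realType) (lam a : R) (u x y : g4 R) : 0 < lam ->
  nabla lam u (a *: x + y) = a *: nabla lam u x + nabla lam u y.
Proof.
move=> lam0; apply: (ip_nondeg lam0) => w; apply: (@mulfI _ 2); first by lra.
have := koszul u (a *: x + y) w lam0.
have := koszul u x w lam0; have := koszul u y w lam0.
generalize (nabla lam u (a *: x + y)) (nabla lam u x) (nabla lam u y).
move=> N X Y hY hX ->; rewrite ipPl mulrDr mulrCA hX hY.
by rewrite !(bracketPl, bracketPr, ipPl, ipPr); ring.
Qed.

Lemma frame_orthonormal (R : realType) (lam : R) (i j : 'I_4) : 0 < lam ->
  ip lam (frame lam)`_i (frame lam)`_j =
  if i == j then (if i == 3 then -1 else 1) else 0.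
Proof.
move=> lam0; set s := Num.sqrt lam; set t : R := Num.sqrt 2.
have s2 : s ^+ 2 = lam by rewrite sqr_sqrtr // ltW.
have t2 : t ^+ 2 = 2 by rewrite sqr_sqrtr.
have s0 : s != 0 by rewrite sqrtr_eq0 -ltNge.
have t0 : t != 0 by rewrite sqrtr_eq0 -ltNge.
move: i j; apply: ord4E; apply: ord4E;
  rewrite ipE /= !mxE /= -/s -/t -?s2; field: t2; rewrite ?s0 ?t0 //.
Qed.

Lemma frame_basis (R : realType) (lam : R) : 0 < lam ->
  basis_of fullv (frame lam).
Proof.
move=> lam0.
rewrite basisEfree subvf size_tuple dimvf /= [dim _]muln1 leqnn andbT.
apply/freeP => k k0 i.
have := congr1 (fun x => ip lam x (frame lam)`_i) k0.
have -> : ip lam 0 (frame lam)`_i = 0 by rewrite ipE !mxE; ring.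
rewrite sum4E -!addrA !ipPl.
rewrite -[k 3 *: _]addr0 ipPl.
have -> : ip lam 0 (frame lam)`_i = 0 by rewrite ipE !mxE; ring.
move: i; apply: ord4E;
by rewrite !(frame_orthonormal _ _ lam0) /=; lra.
Qed.

Lemma J_frame (R : realType) (lam : R) (j : 'I_4) : 0 < lam ->
  J lam (frame lam)`_j = (if j == 3 then -1 else 1) *: (frame lam)`_j.
Proof.
move=> lam0; have fr := basis_free (frame_basis lam0).
rewrite /J (bigD1 j) //= coord_free // eqxx mulr1 big1 ?addr0 // => i ij.
by rewrite coord_free // (eq_sym j) (negPf ij) mulr0 scale0r.
Qed.

Lemma frame_mxP (R : realType) (lam : R) (f : g4 R -> g4 R) (j : 'I_4) :
  0 < lam ->
  f (frame lam)`_j = \sum_(i < 4) frame_mx lam f i j *: (frame lam)`_i.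
Proof.
move=> lam0; rewrite [LHS](coord_basis (frame_basis lam0) (memvf _)).
by apply: eq_bigr => i _; rewrite mxE.
Qed.

Lemma JP (R : realType) (lam a : R) (x y : g4 R) :
  J lam (a *: x + y) = a *: J lam x + J lam y.
Proof.
rewrite /J scaler_sumr -big_split; apply: eq_bigr => i _ /=.
by rewrite linearP scalerA -scalerDl; congr (_ *: _); rewrite /=; ring.
Qed.

Lemma nabla0Pl (R : realType) (lam a : R) (x y v : g4 R) : 0 < lam ->
  nabla0 lam (a *: x + y) v = a *: nabla0 lam x v + nabla0 lam y v.
Proof.
move=> lam0; rewrite /nabla0 /nablaJ !nablaPl // JP.
repeat match goal with |- context [J ?l (nabla ?m ?t ?x)] =>
  generalize (J l (nabla m t x)); intro end.
repeat match goal with |- context [nabla ?l ?t ?x] =>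
  generalize (nabla l t x); intro end.
by apply/matrixP => i j; rewrite !mxE; ring.
Qed.

Lemma nabla0Pr (R : realType) (lam a : R) (u x y : g4 R) : 0 < lam ->
  nabla0 lam u (a *: x + y) = a *: nabla0 lam u x + nabla0 lam u y.
Proof.
move=> lam0; rewrite /nabla0 /nablaJ !(JP, nablaPr) //.
repeat match goal with |- context [J ?l (nabla ?m ?t ?x)] =>
  generalize (J l (nabla m t x)); intro end.
repeat match goal with |- context [nabla ?l ?t ?x] =>
  generalize (nabla l t x); intro end.
by apply/matrixP => i j; rewrite !mxE; ring.
Qed.

Lemma Ric0P (R : realType) (lam a : R) (x y : g4 R) : 0 < lam ->
  Ric0 lam (a *: x + y) = a *: Ric0 lam x + Ric0 lam y.
Proof.
move=> lam0; rewrite /Ric0 scaler_sumr -big_split; apply: eq_bigr => k _ /=.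
rewrite /R0 bracketPr !(nabla0Pl, nabla0Pr) //.
repeat match goal with |- context [nabla0 ?l ?t (nabla0 ?m ?z ?x)] =>
  generalize (nabla0 l t (nabla0 m z x)); intro end.
repeat match goal with |- context [nabla0 ?l ?t ?x] =>
  generalize (nabla0 l t x); intro end.
by apply/matrixP => i j; rewrite !mxE; ring.
Qed.

Lemma ip_sym_Ric0 (R : realType) (lam : R) (u v : g4 R) : 0 < lam ->
  ip lam (sym_Ric0 lam u) v = sym_rho0 lam u v.
Proof.
move=> lam0; rewrite ip_sharp // => a x y.
rewrite /sym_rho0 /rho0 (Ric0P a x y lam0).
generalize (Ric0 lam u) (Ric0 lam x) (Ric0 lam y) => U X Y.
by rewrite ipPl ipPr; ring.
Qed.

(* Main.v *)
(* Since J^2 = 1, nabla^0_u v = (nabla_u v + J (nabla_u (J v))) / 2, and J just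
   exchanges the e_2 and e_4 coordinates.  Summing over the orthonormal frame
   amounts to contracting with the inverse Gram matrix, so all square roots
   disappear and, in the basis (e_1, ..., e_4), the symmetrized Ricci operator
   is diag(-a, b, a, b) + 2 b E_42 with a = (lambda + 1) / 4 and
   b = (1 - lambda^2) / (8 lambda).  Subtracting c Id and testing the
   derivation rule on [e_1, e_2] = e_3 and [e_1, e_3] = e_4 gives - a - c = 0
   and b - c = a - c, whence lambda = 1/3 and c = - 1/3. *)
Require Import Defs.
From mathcomp Require Import all_boot all_order all_algebra.
From mathcomp Require Import reals.
From mathcomp Require Import ring lra.
Import Order.TTheory GRing.Theory Num.Theory.
Local Open Scope ring_scope.

(** * Coordinate formulas for [J] and the two connections *)

Definition vec4 {R : realType} (a b c d : R) : g4 R :=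
  \col_i nth 0 [:: a; b; c; d] i.

Lemma JE (R : realType) (lam : R) (u : g4 R) : 0 < lam ->
  J lam u = vec4 (u 0 0) (u 3 0) (u 2 0) (u 1 0).
Proof.
move=> lam0; have := coord_basis (frame_basis lam0) (memvf u).
rewrite /J !sum4E.
(* The frame coordinates stay abstract: once [u] is replaced by its expansion, both sides are linear
   in them, whatever the value of the square roots. *)
move: (coord _ 0 u) (coord _ 1 u) (coord _ 2 u) (coord _ 3 u) => a b c d ->.
by apply: eqV4; rewrite !mxE /=; ring.
Qed.

Lemma sharpE (R : realType) (lam : R) (f : g4 R -> R) : 0 < lam ->
  sharp lam f = vec4 (f (e R 0)) (f (e R 3)) (f (e R 2) / lam) (f (e R 1)).
Proof.
move=> lam0; have lam_neq0 : lam != 0 by rewrite gt_eqF.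
rewrite /sharp -[RHS](mulKmx (gram_unit lam0)); congr (_ *m _).
by apply: eqV4; rewrite !mxE sum4E !mxE /=; field.
Qed.

Lemma nablaE (R : realType) (lam : R) (u v : g4 R) : 0 < lam ->
  nabla lam u v =
  vec4 ((lam + 1) * (u 1 0 * v 2 0 + u 2 0 * v 1 0) / 2)
       0
       (((lam - 1) * u 0 0 * v 1 0 - (lam + 1) * u 1 0 * v 0 0) / (2 * lam))
       (((1 - lam) * u 0 0 * v 2 0 - (lam + 1) * u 2 0 * v 0 0) / 2).
Proof.
move=> lam0; have lam_neq0 : lam != 0 by rewrite gt_eqF.
rewrite /nabla sharpE //.
by apply: eqV4; rewrite !mxE /= !ipE !mxE /=; field.
Qed.

(** [J] is an isometry, so nabla^0 preserves both [J] and the metric. The -1 eigenspace of [J] is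
    the line of v_4, so v_4 is parallel: [v] enters only through its e_1 and e_3 coordinates and the
    sum of the other two, and the e_2 and e_4 entries of the result agree. *)
Lemma nabla0E (R : realType) (lam : R) (u v : g4 R) : 0 < lam ->
  let h := ((1 - lam) * u 0 0 * v 2 0 - (lam + 1) * u 2 0 * v 0 0) / 4 in
  nabla0 lam u v =
  vec4 ((lam + 1) * (2 * u 1 0 * v 2 0 + u 2 0 * (v 1 0 + v 3 0)) / 4)
       h
       (((lam - 1) * u 0 0 * (v 1 0 + v 3 0) - 2 * (lam + 1) * u 1 0 * v 0 0)
          / (4 * lam))
       h.
Proof.
move=> lam0; have lam_neq0 : lam != 0 by rewrite gt_eqF.
rewrite /nabla0 /nablaJ !nablaE // !JE //.
by apply: eqV4; rewrite !mxE /=; field.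
Qed.

(** * Curvature and Ricci operators *)

Lemma vec4_eta (R : realType) (u : g4 R) :
  u = vec4 (u 0 0) (u 1 0) (u 2 0) (u 3 0).
Proof. by apply: eqV4; rewrite !mxE. Qed.

Lemma vec4D (R : realType) (a b c d a' b' c' d' : R) :
  vec4 a b c d + vec4 a' b' c' d' = vec4 (a + a') (b + b') (c + c') (d + d').
Proof. by apply: eqV4; rewrite !mxE. Qed.

Lemma vec4N (R : realType) (a b c d : R) :
  - vec4 a b c d = vec4 (- a) (- b) (- c) (- d).
Proof. by apply: eqV4; rewrite !mxE. Qed.

Lemma bracket_vec4 (R : realType) (a b c d a' b' c' d' : R) :
  bracket (vec4 a b c d) (vec4 a' b' c' d') =
  vec4 0 0 (a * b' - b * a') (a * c' - c * a').
Proof. by apply: eqV4; rewrite !mxE /=; ring. Qed.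

Lemma nabla0_vec4 (R : realType) (lam a b c d a' b' c' d' : R) : 0 < lam ->
  let h := ((1 - lam) * a * c' - (lam + 1) * c * a') / 4 in
  nabla0 lam (vec4 a b c d) (vec4 a' b' c' d') =
  vec4 ((lam + 1) * (2 * b * c' + c * (b' + d')) / 4)
       h
       (((lam - 1) * a * (b' + d') - 2 * (lam + 1) * b * a') / (4 * lam))
       h.
Proof. by move=> lam0; rewrite nabla0E // !mxE. Qed.

Definition simp0 := (mul0r, mulr0, add0r, addr0, oppr0, subr0).

Lemma R0_e0 (R : realType) (lam a : R) (u : g4 R) : 0 < lam ->
  let h := a ^+ 2 * ((lam + 1) * (1 - 3 * lam) / (8 * lam)) * u 1 0 in
  R0 lam (vec4 a 0 0 0) u (vec4 a 0 0 0) =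
  vec4 0 h (a ^+ 2 * ((lam ^+ 2 - 1) / (8 * lam)) * u 2 0) h.
Proof.
move=> lam0 h; have lam_neq0 : lam != 0 by rewrite gt_eqF.
rewrite /h [u in LHS]vec4_eta; move: (u 0 0) (u 1 0) (u 2 0) (u 3 0) => x y z t.
rewrite /R0 bracket_vec4 !simp0.
rewrite !(nabla0_vec4 _ _ _ _ _ _ _ _ _ _ lam0) !simp0.
by rewrite !(vec4N, vec4D) !simp0; congr vec4; field.
Qed.

Lemma R0_e2 (R : realType) (lam a : R) (u : g4 R) : 0 < lam ->
  let h := a ^+ 2 * ((lam + 1) ^+ 2 / 8) * u 1 0 in
  R0 lam (vec4 0 0 a 0) u (vec4 0 0 a 0) =
  vec4 (a ^+ 2 * ((lam ^+ 2 - 1) / 8) * u 0 0) h 0 h.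
Proof.
move=> lam0 h; have lam_neq0 : lam != 0 by rewrite gt_eqF.
rewrite /h [u in LHS]vec4_eta; move: (u 0 0) (u 1 0) (u 2 0) (u 3 0) => x y z t.
rewrite /R0 bracket_vec4 !simp0.
rewrite !(nabla0_vec4 _ _ _ _ _ _ _ _ _ _ lam0) !simp0.
by rewrite !(vec4N, vec4D) !simp0; congr vec4; field.
Qed.

(** Joint contribution of v_3 and v_4, whose norms are opposite. By polarization only the cross
    terms in e_2 and e_4 survive in the difference. *)
Lemma R0_hyperbolic_plane (R : realType) (lam a : R) (u : g4 R) : 0 < lam ->
  let p := vec4 0 a 0 a in
  let m := vec4 0 a 0 (- a) in
  R0 lam p u p - R0 lam m u m =
  vec4 (- a ^+ 2 * ((lam + 1) * (3 * lam - 1) / (4 * lam)) * u 0 0) 0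
       (a ^+ 2 * ((lam + 1) ^+ 2 / (4 * lam)) * u 2 0) 0.
Proof.
move=> lam0 p m; have lam_neq0 : lam != 0 by rewrite gt_eqF.
rewrite [u in LHS]vec4_eta; move: (u 0 0) (u 1 0) (u 2 0) (u 3 0) => x y z t.
rewrite /R0 !bracket_vec4 !simp0.
rewrite !(nabla0_vec4 _ _ _ _ _ _ _ _ _ _ lam0) !simp0.
by rewrite !(vec4N, vec4D) !simp0; congr vec4; field.
Qed.

Lemma sum_frame (R : realType) (lam : R) (F : g4 R -> g4 R) : 0 < lam ->
  let s := (Num.sqrt lam)^-1 in
  let t := (Num.sqrt 2)^-1 in
  \sum_(k < 4) ip lam (frame lam)`_k (frame lam)`_k *: F (frame lam)`_k =
  F (vec4 1 0 0 0) + F (vec4 0 0 s 0)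
  + (F (vec4 0 t 0 t) - F (vec4 0 t 0 (- t))).
Proof.
move=> lam0 s t; rewrite sum4E !frame_orthonormal //= !scale1r scaleN1r addrA.
by congr (F _ + F _ + F _ - F _); rewrite /s /t;
  apply: eqV4; rewrite !mxE /=; ring.
Qed.

Lemma Ric0E (R : realType) (lam : R) (u : g4 R) : 0 < lam ->
  let h := (1 - lam ^+ 2) / (4 * lam) * u 1 0 in
  Ric0 lam u =
  vec4 (- ((lam + 1) / 4) * u 0 0) h ((lam + 1) / 4 * u 2 0) h.
Proof.
move=> lam0 h; have lam_neq0 : lam != 0 by rewrite gt_eqF.
rewrite /h /Ric0 (sum_frame _ _ (fun v => R0 lam v u v) lam0).
rewrite [X in _ + X](R0_hyperbolic_plane _ _ _ _ lam0).
rewrite [X in X + _ + _](R0_e0 _ _ _ _ lam0).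
rewrite [X in _ + X + _](R0_e2 _ _ _ _ lam0).
(* The normalizing factors occur only squared, as 1 / lambda and 1 / 2. *)
rewrite !exprVn !sqr_sqrtr ?(ltW lam0) ?ler0n //.
by rewrite !vec4D; congr vec4; field.
Qed.

(** [Ric0] sends e_2 to 2 b (e_2 + e_4) and kills e_4. The metric pairs e_2 with e_4, so the adjoint
    of E_22 is E_44, while E_42 is self-adjoint; averaging splits 2 b E_22 into b (E_22 + E_44). *)
Lemma sym_Ric0E (R : realType) (lam : R) (u : g4 R) : 0 < lam ->
  let a := (lam + 1) / 4 in
  let b := (1 - lam ^+ 2) / (8 * lam) in
  sym_Ric0 lam u =
  vec4 (- a * u 0 0) (b * u 1 0) (a * u 2 0) (b * (2 * u 1 0 + u 3 0)).
Proof.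
move=> lam0 a b; have lam_neq0 : lam != 0 by rewrite gt_eqF.
rewrite /a /b /sym_Ric0 sharpE // /sym_rho0 /rho0 !Ric0E //.
by apply: eqV4; rewrite !mxE /= !ipE !mxE /=; field.
Qed.

(** * Solving the soliton equation *)

Lemma soliton_constants (R : realType) (lam c : R) (D : g4 R -> g4 R) :
  0 < lam -> is_derivation D -> soliton_eq lam c D ->
  c = - (1 / 3) /\ lam = 1 / 3.
Proof.
move=> lam0 Dder Dsol; have lam_neq0 : lam != 0 by rewrite gt_eqF.
have DE u : D u = sym_Ric0 lam u - c *: u by rewrite Dsol addrC addKr.
have := congr1 (fun x : g4 R => x 2 0) (Dder (e R 0) (e R 1)).
have := congr1 (fun x : g4 R => x 3 0) (Dder (e R 0) (e R 2)).
rewrite !DE !sym_Ric0E // !mxE /=.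
set b := _ / (8 * lam).
have bE : 8 * lam * b = 1 - lam ^+ 2 by rewrite /b; field.
(* With a = (lambda + 1) / 4, [h1] amounts to b + c = 0 and [h2] to b - c = 2 a. *)
move=> h1 h2; have cE : c = - ((lam + 1) / 4) by lra.
have bE' : b = (lam + 1) / 4 by lra.
have : (lam + 1) * (3 * lam - 1) = 0 by move: bE; rewrite bE' => bE; lra.
by move/eqP; rewrite mulf_eq0 => /orP[]/eqP; split; lra.
Qed.

Lemma sym_Ric0_third (R : realType) (u : g4 R) :
  sym_Ric0 (1 / 3) u =
  vec4 (- (1 / 3) * u 0 0) (1 / 3 * u 1 0) (1 / 3 * u 2 0)
       (2 / 3 * u 1 0 + 1 / 3 * u 3 0).
Proof. by rewrite sym_Ric0E; [congr vec4; field | lra]. Qed.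

Lemma frame_mx_uniq (R : realType) (lam : R) (f : g4 R -> g4 R) (M : 'M[R]_4) :
  0 < lam ->
  (forall j : 'I_4, f (frame lam)`_j = \sum_(i < 4) M i j *: (frame lam)`_i) ->
  frame_mx lam f = M.
Proof.
move=> lam0 fE; apply/matrixP => i j.
by rewrite mxE fE coord_sum_free // (basis_free (frame_basis lam0)).
Qed.

Theorem theorem3p4 (R : realType) (lam : R) (lam_gt0 : 0 < lam) :
  (forall c : R,
     second_kind_soliton lam c <-> c = - (1 / 3) /\ lam = 1 / 3) /\
  (forall (c : R) (D : {linear g4 R -> g4 R}),
     is_derivation D -> soliton_eq lam c D ->
     frame_mx lam (sym_Ric0 lam) =
       mx4 [:: [:: - (1 / 3); 0;     0;         0];
               [:: 0;         1 / 3; 0;         0];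
               [:: 0;         0;     2 / 3;     1 / 3];
               [:: 0;         0;     - (1 / 3); 0]] /\
     frame_mx lam D =
       mx4 [:: [:: 0; 0;     0;         0];
               [:: 0; 2 / 3; 0;         0];
               [:: 0; 0;     1;         1 / 3];
               [:: 0; 0;     - (1 / 3); 1 / 3]]).
Proof.
split=> [c|c D Dder Dsol]; first split=> [[D [Dder Dsol]]|[-> ->]].
- exact: soliton_constants Dder Dsol.
(* [M] is the matrix of [sym_Ric0] + 1/3 Id at lambda = 1/3 in the basis (e_1, ..., e_4), the only
   candidate for D. *)
- pose M : 'M[R]_4 := mx4 [:: [:: 0; 0; 0; 0]; [:: 0; 2 / 3; 0; 0];
                            [:: 0; 0; 2 / 3; 0]; [:: 0; 2 / 3; 0; 2 / 3]].
  have ME u : M *m u =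
      vec4 0 (2 / 3 * u 1 0) (2 / 3 * u 2 0) (2 / 3 * (u 1 0 + u 3 0)).
    by apply: eqV4; rewrite !mxE sum4E !mxE /=; ring.
  exists (mulmx M) => /=; split=> [u v|u]; rewrite /= ?sym_Ric0_third !ME.
    by rewrite /bracket; apply: eqV4; rewrite !mxE /=; ring.
  by apply: eqV4; rewrite !mxE /=; field.
have [cE lamE] := soliton_constants _ _ _ _ lam_gt0 Dder Dsol.
have DE u : D u = sym_Ric0 lam u - c *: u by rewrite Dsol addrC addKr.
subst lam c.
split; apply: frame_mx_uniq => // j; rewrite ?DE sym_Ric0_third sum4E /frame;
  (* Both matrices are insensitive to the scale of v_2 and to the common scale of v_3 and v_4, so
     the roots can be made arbitrary. *)
  move: (Num.sqrt _)^-1 (Num.sqrt _)^-1 => s t; move: j; apply: ord4E;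
  by apply: eqV4; rewrite !mxE /=; field.
Qed.
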